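(* Let $(\mathcal{A},\mathcal{H},D;J)$ be a real spectral triple, possibly not fulfilling the first-order condition. Let $A=\sum_j a_j\delta(b_j)\in\Omega^1(\mathcal{A})$ be a universal one-form and let $$D(A)=D+\sum_j a_j[D,b_j]+\sum_j\hat a_j[D,\hat b_j]+\sum_{j,k}\hat a_j\big[a_k[D,b_k],\hat b_j\big].$$ Let $u\in\mathcal{A}$ be unitary and $U=u\,JuJ^{-1}$. Then $$U\,D(A)\,U^*=D(\gamma_u(A)),\qquad \gamma_u(A)=u\,\delta(u^* )+uAu^*\in\Omega^1(\mathcal{A}).$$
   Context: Real spectral triple (first-order condition not assumed): a unital involutive algebra $\mathcal{A}$ represented by bounded operators on a Hilbert space $\mathcal{H}$, a self-adjoint operator $D$ with compact resolvent such that each $a\in\mathcal{A}$ preserves $\mathrm{Dom}(D)$ and $[D,a]$ is bounded, and an antilinear isometry $J$ of $\mathcal{H}$ onto itself with $J^2=\pm1$, $JDJ^{-1}=\epsilon D$ for some $\epsilon\in\{\pm1\}$, and $[a,JbJ^{-1}]=0$ for all $a,b\in\mathcal{A}$. The first-order condition would be $[[D,a],JbJ^{-1}]=0$ for all $a,b\in\mathcal{A}$. Notation: $\hat T=JTJ^{-1}$ for an operator $T$ on $\mathcal{H}$. $\Omega^1(\mathcal{A})$ is the $\mathcal{A}$-bimodule of universal one-forms, spanned by $a\,\delta(b)$ with $a,b\in\mathcal{A}$, where $\delta$ is the universal derivation ($\delta(ab)=\delta(a)b+a\delta(b)$, $\delta(1)=0$). The operator $D(A)$ depends only on the one-form $A$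 and not on its presentation. *)

(* Defs.v *)
From HB Require Import structures.
From mathcomp Require Import all_boot all_order all_algebra generic_quotient.
From mathcomp Require Import complex.
From mathcomp Require Import all_classical all_reals all_analysis.

Set Implicit Arguments.
Unset Strict Implicit.
Unset Printing Implicit Defensive.

Import Order.TTheory GRing.Theory Num.Theory Num.Def.
Import numFieldNormedType.Exports.

Local Open Scope classical_set_scope.
Local Open Scope quotient_scope.
Local Open Scope ring_scope.

(* The algebra of a real spectral triple may be complex or merely real (e.g.
   contain the quaternions), so its ground field is a field with involution
   embedded in the complex numbers; see [complex_scalars] and [real_scalars]. *)
Record scalars (R : realType) := Scalars {
  scalar_field :> fieldType ;
  scalar_conj : {rmorphism scalar_field -> scalar_field} ;
  scalar_embed : {rmorphism scalar_field -> R[i]} ;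
  scalar_embed_conj : forall k,
    scalar_embed (scalar_conj k) = conjC (scalar_embed k)
}.

Definition complex_scalars (R : realType) : scalars R :=
  @Scalars R R[i] conjC idfun (fun=> erefl).

Lemma real_embed_conj (R : realType) (k : R) :
  real_complex R (idfun k) = conjC (real_complex R k).
Proof. by apply/esym/CrealP; rewrite complex_real. Qed.

Definition real_scalars (R : realType) : scalars R :=
  @Scalars R R idfun (real_complex R) (@real_embed_conj R).

HB.mixin Record isInvolutiveAlgebra (R : realType) (K : scalars R) A
    of GRing.Algebra K A := {
  star : A -> A ;
  starK : involutive star ;
  starM : forall a b, star (a * b) = star b * star a ;
  starD : forall a b, star (a + b) = star a + star b ;
  starZ : forall (k : K) a, star (k *: a) = scalar_conj K k *: star a
}.

#[short(type="starAlgType")]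
HB.structure Definition InvolutiveAlgebra (R : realType) (K : scalars R) :=
  { A of isInvolutiveAlgebra R K A & GRing.Algebra K A }.

Definition unitary (R : realType) (K : scalars R) (A : starAlgType K) (u : A) :=
  u * star u = 1 /\ star u * u = 1.

HB.mixin Record Lmodule_isBimodule (K : fieldType) (A : algType K) M
    of GRing.Lmodule A M := {
  rscale : M -> A -> M ;
  rscalerA : forall m a b, rscale (rscale m a) b = rscale m (a * b) ;
  rscaler1 : forall m, rscale m 1 = m ;
  rscalerDl : forall m n a, rscale (m + n) a = rscale m a + rscale n a ;
  rscalerDr : forall m a b, rscale m (a + b) = rscale m a + rscale m b ;
  scalerscaleA : forall a m b, rscale (a *: m) b = a *: rscale m b ;
  scaler_central : forall (k : K) m, k%:A *: m = rscale m k%:A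
}.

#[short(type="bimodType")]
HB.structure Definition Bimodule (K : fieldType) (A : algType K) :=
  { M of Lmodule_isBimodule K A M & GRing.Lmodule A M }.

Definition derivation (K : fieldType) (A : algType K) (M : bimodType A)
    (d : A -> M) : Prop :=
  [/\ forall a b, d (a + b) = d a + d b,
      forall (k : K) a, d (k *: a) = k%:A *: d a &
      forall a b, d (a * b) = rscale (d a) b + a *: d b].

Section OneForms.
Variables (K : fieldType) (A : algType K).

(* [:: (a_1, b_1); ...; (a_n, b_n)] stands for \sum_j a_j delta(b_j). *)
Definition presentation := seq (A * A).

Definition form_eval (M : bimodType A) (d : A -> M) (s : presentation) : M :=
  \sum_(p <- s) p.1 *: d p.2.

(* Two presentations name the same universal one-form when no derivation into
   an A-bimodule distinguishes them.  The quotient is the bimodule spanned by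
   the a delta(b): delta is a derivation ([delta_derivation]), the forms
   a delta(b) span ([Omega1_span]), and every derivation factors uniquely
   through delta ([Omega1_universal]). *)
Definition pres_eq (s t : presentation) : Prop :=
  forall (M : bimodType A) (d : A -> M),
    derivation d -> form_eval d s = form_eval d t.

Definition pres_eqb (s t : presentation) : bool := `[< pres_eq s t >].

Lemma pres_eqb_refl : reflexive pres_eqb.
Proof. by move=> s; apply/asboolP. Qed.

Lemma pres_eqb_sym : symmetric pres_eqb.
Proof.
by move=> s t; apply/asboolP/asboolP => st M d dd; rewrite (st M d dd).
Qed.

Lemma pres_eqb_trans : transitive pres_eqb.
Proof.
move=> s t r /asboolP ts /asboolP sr; apply/asboolP => M d dd.
by rewrite (ts M d dd) (sr M d dd).
Qed.

Canonical pres_equiv :=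
  EquivRel pres_eqb pres_eqb_refl pres_eqb_sym pres_eqb_trans.

Definition Omega1 := {eq_quot pres_equiv}.

HB.instance Definition _ := Choice.on Omega1.
HB.instance Definition _ := EqQuotient.on Omega1.

Definition Omega1_eval (M : bimodType A) (d : A -> M) (w : Omega1) : M :=
  form_eval d (repr w).

Lemma Omega1_eval_pi (M : bimodType A) (d : A -> M) s :
  derivation d -> Omega1_eval d (\pi_Omega1 s) = form_eval d s.
Proof.
move=> dd; rewrite /Omega1_eval.
have /eqmodP/asboolP : \pi_Omega1 (repr (\pi_Omega1 s)) = \pi_Omega1 s.
  by rewrite reprK.
exact.
Qed.

Lemma Omega1_ext (v w : Omega1) :
  (forall (M : bimodType A) (d : A -> M),
     derivation d -> Omega1_eval d v = Omega1_eval d w) -> v = w.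
Proof.
by move=> vw; rewrite -[v]reprK -[w]reprK; apply/eqmodP/asboolP.
Qed.

Definition Omega1_zero : Omega1 := \pi_Omega1 [::].
Definition Omega1_add (v w : Omega1) : Omega1 :=
  \pi_Omega1 (repr v ++ repr w).
Definition Omega1_opp (w : Omega1) : Omega1 :=
  \pi_Omega1 [seq (- p.1, p.2) | p <- repr w].
Definition Omega1_scale (a : A) (w : Omega1) : Omega1 :=
  \pi_Omega1 [seq (a * p.1, p.2) | p <- repr w].
(* (a delta(b)) c = a delta(bc) - ab delta(c) *)
Definition Omega1_rscale (w : Omega1) (c : A) : Omega1 :=
  \pi_Omega1 ([seq (p.1, p.2 * c) | p <- repr w] ++
              [seq (- (p.1 * p.2), c) | p <- repr w]).

Section Eval.
Variables (M : bimodType A) (d : A -> M).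
Hypothesis dd : derivation d.

Lemma Omega1_eval0 : Omega1_eval d Omega1_zero = 0.
Proof. by rewrite Omega1_eval_pi// /form_eval big_nil. Qed.

Lemma Omega1_evalD v w :
  Omega1_eval d (Omega1_add v w) = Omega1_eval d v + Omega1_eval d w.
Proof. by rewrite Omega1_eval_pi// /form_eval big_cat. Qed.

Lemma Omega1_evalN w : Omega1_eval d (Omega1_opp w) = - Omega1_eval d w.
Proof.
rewrite Omega1_eval_pi// /form_eval big_map/= -sumrN.
by apply: eq_bigr => p _; rewrite scaleNr.
Qed.

Lemma Omega1_evalZ a w : Omega1_eval d (Omega1_scale a w) = a *: Omega1_eval d w.
Proof.
rewrite Omega1_eval_pi// /form_eval big_map/= scaler_sumr.
by apply: eq_bigr => p _; rewrite scalerA.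
Qed.

Lemma rscale0 (N : bimodType A) (a : A) : rscale (0 : N) a = 0.
Proof. by apply: (addrI (rscale (0 : N) a)); rewrite -rscalerDl !addr0. Qed.

Lemma Omega1_evalR w c : Omega1_eval d (Omega1_rscale w c) = rscale (Omega1_eval d w) c.
Proof.
rewrite Omega1_eval_pi// /form_eval big_cat !big_map/= -big_split/=.
rewrite /Omega1_eval /form_eval.
elim: (repr w) => [|p s IH]; first by rewrite !big_nil rscale0.
rewrite !big_cons IH rscalerDl; congr (_ + _).
case: dd => _ _ ->; rewrite scalerscaleA scalerDr scalerA scaleNr.
by rewrite addrK.
Qed.
End Eval.

Let addA : associative Omega1_add.
Proof.
by move=> u v w; apply: Omega1_ext => M d dd; rewrite !Omega1_evalD// addrA.
Qed.
Let addC : commutative Omega1_add.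
Proof.
by move=> u v; apply: Omega1_ext => M d dd; rewrite !Omega1_evalD// addrC.
Qed.
Let add0 : left_id Omega1_zero Omega1_add.
Proof.
move=> v; apply: Omega1_ext => M d dd.
by rewrite !Omega1_evalD// Omega1_eval0// add0r.
Qed.
Let addN : left_inverse Omega1_zero Omega1_opp Omega1_add.
Proof.
move=> v; apply: Omega1_ext => M d dd.
by rewrite !Omega1_evalD// Omega1_evalN// Omega1_eval0// addNr.
Qed.

HB.instance Definition _ := GRing.isZmodule.Build Omega1 addA addC add0 addN.

Let scaleA a b w : Omega1_scale a (Omega1_scale b w) = Omega1_scale (a * b) w.
Proof.
by apply: Omega1_ext => M d dd; rewrite !Omega1_evalZ// scalerA.
Qed.
Let scale1 : left_id 1 Omega1_scale.
Proof.
by move=> w; apply: Omega1_ext => M d dd; rewrite !Omega1_evalZ// scale1r.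
Qed.
Let scaleDr : right_distributive Omega1_scale +%R.
Proof.
move=> a v w; apply: Omega1_ext => M d dd.
by rewrite Omega1_evalZ// !Omega1_evalD// !Omega1_evalZ// scalerDr.
Qed.
Let scaleDl w : {morph Omega1_scale^~ w : a b / a + b}.
Proof.
move=> a b; apply: Omega1_ext => M d dd.
by rewrite !Omega1_evalD// !Omega1_evalZ// scalerDl.
Qed.

HB.instance Definition _ :=
  GRing.Zmodule_isLmodule.Build A Omega1 scaleA scale1 scaleDr scaleDl.

Let rscaleA w a b :
  Omega1_rscale (Omega1_rscale w a) b = Omega1_rscale w (a * b).
Proof.
by apply: Omega1_ext => M d dd; rewrite !Omega1_evalR// rscalerA.
Qed.
Let rscale1 w : Omega1_rscale w 1 = w.
Proof.
by apply: Omega1_ext => M d dd; rewrite !Omega1_evalR// rscaler1.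
Qed.
Let rscaleDl (v w : Omega1) a :
  Omega1_rscale (v + w) a = Omega1_rscale v a + Omega1_rscale w a.
Proof.
apply: Omega1_ext => M d dd.
by rewrite Omega1_evalR// !Omega1_evalD// !Omega1_evalR// rscalerDl.
Qed.
Let rscaleDr w a b :
  Omega1_rscale w (a + b) = Omega1_rscale w a + Omega1_rscale w b.
Proof.
apply: Omega1_ext => M d dd.
by rewrite Omega1_evalR// !Omega1_evalD// !Omega1_evalR// rscalerDr.
Qed.
Let scalerscale a (w : Omega1) b :
  Omega1_rscale (a *: w) b = a *: Omega1_rscale w b.
Proof.
apply: Omega1_ext => M d dd.
by rewrite Omega1_evalR// !Omega1_evalZ// !Omega1_evalR// scalerscaleA.
Qed.
Let scale_central (k : K) (w : Omega1) :
  (k%:A : A) *: w = Omega1_rscale w k%:A.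
Proof.
apply: Omega1_ext => M d dd.
by rewrite Omega1_evalR// !Omega1_evalZ// scaler_central.
Qed.

HB.instance Definition _ :=
  Lmodule_isBimodule.Build K A Omega1
    rscaleA rscale1 rscaleDl rscaleDr scalerscale scale_central.

Definition delta (b : A) : Omega1 := \pi_Omega1 [:: (1, b)].

Lemma Omega1_eval_delta (M : bimodType A) (d : A -> M) b :
  derivation d -> Omega1_eval d (delta b) = d b.
Proof.
by move=> dd; rewrite Omega1_eval_pi// /form_eval big_seq1 scale1r.
Qed.

Lemma delta_derivation : derivation delta.
Proof.
split=> [a b|k a|a b]; apply: Omega1_ext => M d dd.
- by rewrite Omega1_evalD// !Omega1_eval_delta//; case: dd.
- by rewrite Omega1_evalZ// !Omega1_eval_delta//; case: dd.
- rewrite Omega1_evalD// Omega1_evalR// Omega1_evalZ// !Omega1_eval_delta//.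
  by case: dd.
Qed.

Lemma delta1 : delta 1 = 0.
Proof.
have [_ _ /(_ 1 1)] := delta_derivation.
rewrite mulr1 rscaler1 scale1r => /eqP.
by rewrite -subr_eq0 opprD addrA subrr sub0r oppr_eq0 => /eqP.
Qed.

Lemma Omega1_eval_sum (M : bimodType A) (d : A -> M) (s : presentation) :
  derivation d -> Omega1_eval d (form_eval delta s) = form_eval d s.
Proof.
move=> dd; rewrite /form_eval; elim: s => [|p s IH].
  by rewrite !big_nil (Omega1_eval0 dd).
by rewrite !big_cons (Omega1_evalD dd) (Omega1_evalZ dd) Omega1_eval_delta// IH.
Qed.

Lemma Omega1_span (w : Omega1) :
  exists s : presentation, w = \sum_(p <- s) p.1 *: delta p.2.
Proof.
exists (repr w); apply: Omega1_ext => M d dd.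
by rewrite [RHS](Omega1_eval_sum _ dd).
Qed.

Lemma Omega1_universal (M : bimodType A) (d : A -> M) : derivation d ->
  exists! f : Omega1 -> M,
    [/\ forall v w, f (v + w) = f v + f w,
        forall a w, f (a *: w) = a *: f w,
        forall w a, f (rscale w a) = rscale (f w) a &
        forall b, f (delta b) = d b].
Proof.
move=> dd; exists (Omega1_eval d); split.
  split=> *; [exact: Omega1_evalD|exact: Omega1_evalZ|exact: Omega1_evalR|].
  exact: Omega1_eval_delta.
move=> f [fD fZ _ fd]; apply/funext => w.
have f0 : f 0 = 0 by apply: (addrI (f 0)); rewrite -fD !addr0.
have [s ->] := Omega1_span w; rewrite (Omega1_eval_sum _ dd) /form_eval.
elim: s => [|p s IH]; first by rewrite !big_nil f0.
by rewrite !big_cons fD fZ fd IH.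
Qed.

End OneForms.

Definition gauge_form (R : realType) (K : scalars R) (A : starAlgType K)
    (u : A) (w : Omega1 A) : Omega1 A :=
  u *: delta (star u) + rscale (u *: w) (star u).

(* The inner product is linear in its first argument. *)
HB.mixin Record isHilbert (R : realType) H
    of CompleteNormedModule R[i] H := {
  inner : {dot H for conjC} ;
  innerE : forall x : H, inner x x = `|x| ^+ 2
}.

#[short(type="hilbertType")]
HB.structure Definition Hilbert (R : realType) :=
  { H of isHilbert R H & CompleteNormedModule R[i] H }.

(* A partially defined map; the values of [act] outside [dom] are irrelevant. *)
Record partop (H : Type) := PartOp { dom : set H ; act : H -> H }.

Declare Scope partop_scope.
Delimit Scope partop_scope with partop.
Bind Scope partop_scope with partop.

Section PartOp.
Variables (R : realType) (H : hilbertType R).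
Implicit Types S T : partop H.

Definition partop_eq S T := dom S = dom T /\ forall x, dom S x -> act S x = act T x.

Definition total (f : H -> H) : partop H := PartOp setT f.
Definition opp0 : partop H := total (fun=> 0).

(* Sums and products carry their natural domains. *)
Definition opadd S T : partop H :=
  PartOp (dom S `&` dom T) (fun x => act S x + act T x).
Definition opsub S T : partop H :=
  PartOp (dom S `&` dom T) (fun x => act S x - act T x).
Definition opscale (c : R[i]) T : partop H :=
  PartOp (dom T) (fun x => c *: act T x).
Definition opmul S T : partop H :=
  PartOp [set x | dom T x /\ dom S (act T x)] (fun x => act S (act T x)).
Definition commutator S T := opsub (opmul S T) (opmul T S).

Definition linear_op T :=
  dom T 0 /\ forall (c : R[i]) x y, dom T x -> dom T y ->
    dom T (c *: x + y) /\ act T (c *: x + y) = c *: act T x + act T y.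

Definition bounded_op T :=
  exists M : R[i], forall x, dom T x -> `|act T x| <= M * `|x|.

Definition bounded_operator T := [/\ dom T = setT, linear_op T & bounded_op T].

(* For densely defined T the vector z below is unique. *)
Definition adjoint T : partop H :=
  PartOp
    [set y | exists z, forall x, dom T x -> inner (act T x) y = inner x z]
    (fun y => xget 0
       [set z | forall x, dom T x -> inner (act T x) y = inner x z]).

Definition self_adjoint T :=
  [/\ linear_op T, dense (dom T) & partop_eq (adjoint T) T].

Definition is_resolvent T (lambda : R[i]) S :=
  [/\ bounded_operator S,
      partop_eq (opmul (opsub T (total ( *:%R lambda))) S) (total idfun) &
      partop_eq (opmul S (opsub T (total ( *:%R lambda))))
                (PartOp (dom T) idfun)].

Definition compact_operator T :=
  bounded_operator T /\ precompact (act T @` [set x | `|x| <= 1]).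

Definition compact_resolvent T :=
  exists (lambda : R[i]) S, is_resolvent T lambda S /\ compact_operator S.

End PartOp.

Arguments opp0 {R H}.

Notation "S '=op' T" := (partop_eq S T) (at level 70, no associativity).
Notation "S + T" := (opadd S T) : partop_scope.
Notation "S * T" := (opmul S T) : partop_scope.
Notation "c *: T" := (opscale c%R T) : partop_scope.
Notation "[[ S , T ]]" := (commutator S T) : partop_scope.
Notation "\opsum_ ( p <- s ) F" := (\big[@opadd _ _/opp0]_(p <- s) F%partop)
  (at level 36, F at level 36, p, s at level 50,
   format "'[' \opsum_ ( p  <-  s ) '/  '  F ']'") : partop_scope.

Record antilinear_isometry (R : realType) (H : hilbertType R) := AntiIsometry {
  aiso :> H -> H ;
  aiso_inv : H -> H ;
  aisoK : cancel aiso aiso_inv ;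
  aiso_invK : cancel aiso_inv aiso ;
  aiso_antilinear : forall (c : R[i]) x y,
    aiso (c *: x + y) = conjC c *: aiso x + aiso y ;
  aiso_norm : forall x, `|aiso x| = `|x|
}.

Definition hat (R : realType) (H : hilbertType R) (J : antilinear_isometry H)
    (T : partop H) : partop H :=
  (total J * T * total (aiso_inv J))%partop.

Record representation (R : realType) (K : scalars R) (A : starAlgType K)
    (H : hilbertType R) := Representation {
  rep :> A -> H -> H ;
  rep_bounded : forall a, bounded_operator (total (rep a)) ;
  rep1 : forall x, rep 1 x = x ;
  repM : forall a b x, rep (a * b) x = rep a (rep b x) ;
  repD : forall a b x, rep (a + b) x = rep a x + rep b x ;
  repZ : forall (k : K) a x, rep (k *: a) x = scalar_embed K k *: rep a x ;
  rep_star : forall a x y, inner (rep a x) y = inner x (rep (star a) y)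
}.

(* The first-order condition [[ [[D, a]], J b J^-1 ]] = 0 is not imposed. *)
Record real_spectral_triple (R : realType) (K : scalars R) (A : starAlgType K)
    (H : hilbertType R) := RealSpectralTriple {
  rst_rep : representation A H ;
  rst_D : partop H ;
  rst_J : antilinear_isometry H ;
  rst_self_adjoint : self_adjoint rst_D ;
  rst_compact_resolvent : compact_resolvent rst_D ;
  rst_preserves_dom : forall a x, dom rst_D x -> dom rst_D (rst_rep a x) ;
  rst_bounded_commutator : forall a,
    bounded_op [[rst_D, total (rst_rep a)]]%partop ;
  rst_J2 : exists2 eta : R[i], eta = 1 \/ eta = -1 &
    forall x, rst_J (rst_J x) = eta *: x ;
  rst_JD : exists2 epsilon : R[i], epsilon = 1 \/ epsilon = -1 &
    hat rst_J rst_D =op (epsilon *: rst_D)%partop ;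
  rst_commutant : forall a b,
    [[total (rst_rep a), hat rst_J (total (rst_rep b))]]%partop =op opp0
}.

Section Fluctuation.
Variables (R : realType) (K : scalars R) (A : starAlgType K).
Variables (H : hilbertType R) (X : real_spectral_triple A H).

Definition alg_op (a : A) : partop H := total (rst_rep X a).
Definition opp_alg_op (a : A) : partop H := hat (rst_J X) (alg_op a).

(* D(A) for A = \sum_j a_j delta(b_j), as a function of the presentation.
   Its natural domain is dom D: every term is defined at least there, and
   bounded commutators are thus used only through their values on dom D. *)
Definition fluctuated (s : presentation A) : partop H :=
  let D := rst_D X in
  (D
   + (\opsum_(p <- s) (alg_op p.1 * [[D, alg_op p.2]]))
   + (\opsum_(p <- s) (opp_alg_op p.1 * [[D, opp_alg_op p.2]]))
   + (\opsum_(p <- s) \opsum_(q <- s)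
        (opp_alg_op p.1 *
           [[alg_op q.1 * [[D, alg_op q.2]], opp_alg_op p.2]])))%partop.

Definition gauge_op (u : A) : partop H := (alg_op u * opp_alg_op u)%partop.

End Fluctuation.

(* Main.v *)
(* For a representation rho of A on H preserving a subspace V, the linear maps
   V -> H form an A-bimodule in which b |-> [T, rho(b)] is a derivation for
   every linear T : V -> H.  Hence F_rho(T, s) = T + sum_j rho(a_j)[T, rho(b_j)]
   depends only on the one-form presented by s, and
   rho(u) F_rho(T, w) rho(u)^-1 = F_rho(T, gamma_u(w)).
   This applies with V = dom D both to the given action pi and to its conjugate
   hat, which is a representation up to conjugation of scalars.  Regrouping the
   quadratic term yields D(w) = F_hat(F_pi(D, w), w); since pi commutes with hat,
   conjugating by hat(u) and then by pi(u) gauge transforms the two occurrences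
   of w in turn. *)
From HB Require Import structures.
Require Import Defs.
From mathcomp Require Import all_boot all_order all_algebra.
From mathcomp Require Import all_classical all_reals all_analysis.
From mathcomp Require Import complex ring.

Set Implicit Arguments.
Unset Strict Implicit.
Unset Printing Implicit Defensive.

Import Order.TTheory GRing.Theory Num.Theory Num.Def.

Local Open Scope ring_scope.

(* [sr_scalar] need not be the identity: J b J^-1 is antilinear in b. *)
Record subspace_rep (K F : fieldType) (A : algType K) (H : lmodType F) :=
  SubspaceRep {
  sr_dom : set H ;
  sr_act : A -> H -> H ;
  sr_scalar : K -> F ;
  sr_domP : forall c x y, sr_dom x -> sr_dom y -> sr_dom (c *: x + y) ;
  sr_stable : forall a x, sr_dom x -> sr_dom (sr_act a x) ;
  sr_linear : forall a, linear (sr_act a) ;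
  sr_act1 : forall x, sr_act 1 x = x ;
  sr_actM : forall a b x, sr_act (a * b) x = sr_act a (sr_act b x) ;
  sr_actD : forall a b x, sr_act (a + b) x = sr_act a x + sr_act b x ;
  sr_actZ : forall k a x, sr_act (k *: a) x = sr_scalar k *: sr_act a x
}.

Arguments sr_dom {K F A H}.
Arguments sr_act {K F A H}.
Arguments sr_scalar {K F A H}.

HB.instance Definition _ (K F : fieldType) (A : algType K) (H : lmodType F)
    (P : subspace_rep A H) (a : A) :=
  GRing.isLinear.Build F H H *:%R (sr_act P a) (sr_linear P a).

(** * The bimodule of linear maps on an invariant subspace *)

Section LinearOnDomain.
Variables (K F : fieldType) (A : algType K) (H : lmodType F).
Variable P : subspace_rep A H.

Definition linear_on (f : H -> H) := forall c x y, sr_dom P x -> sr_dom P y ->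
  f (c *: x + y) = c *: f x + f y.

(* Extending by 0 makes equality of maps on the domain Leibniz equality. *)
Record dlinear := DLinear {
  dl_fun :> H -> H ;
  dl_linear : linear_on dl_fun ;
  dl_out : forall x, ~ sr_dom P x -> dl_fun x = 0
}.

Lemma dlinear_ext (f g : dlinear) :
  (forall x, sr_dom P x -> f x = g x) -> f = g.
Proof.
move=> fg; have fgE : dl_fun f = dl_fun g.
  apply/funext => x; case: (pselect (sr_dom P x)) => [/fg//|Px].
  by rewrite !dl_out.
case: f g fgE {fg} => [f f1 f2] [g g1 g2] /= fgE.
by subst g; congr DLinear; exact: Prop_irrelevance.
Qed.

Definition cut (f : H -> H) x := if `[< sr_dom P x >] then f x else 0.

Lemma cutE f x : sr_dom P x -> cut f x = f x.
Proof. by rewrite /cut; case: asboolP. Qed.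

Lemma cut_linear f : linear_on f -> linear_on (cut f).
Proof.
by move=> lf c x y Px Py; rewrite !cutE ?lf//; exact: sr_domP.
Qed.

Lemma cut_out f x : ~ sr_dom P x -> cut f x = 0.
Proof. by rewrite /cut; case: asboolP. Qed.

Definition restrict f (lf : linear_on f) : dlinear :=
  DLinear (cut_linear lf) (@cut_out f).

Lemma restrictE f (lf : linear_on f) x : sr_dom P x -> restrict lf x = f x.
Proof. exact: cutE. Qed.

Lemma linear_on0 : linear_on (fun=> 0).
Proof. by move=> c x y _ _; rewrite scaler0 addr0. Qed.

Lemma linear_onD f g :
  linear_on f -> linear_on g -> linear_on (fun x => f x + g x).
Proof.
by move=> lf lg c x y Px Py; rewrite lf// lg// scalerDr addrACA.
Qed.

Lemma linear_onN f : linear_on f -> linear_on (fun x => - f x).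
Proof. by move=> lf c x y Px Py; rewrite lf// opprD scalerN. Qed.

Lemma linear_on_actl a f : linear_on f -> linear_on (fun x => sr_act P a (f x)).
Proof. by move=> lf c x y Px Py; rewrite lf// linearP. Qed.

Lemma linear_on_actr a f : linear_on f -> linear_on (fun x => f (sr_act P a x)).
Proof. by move=> lf c x y Px Py; rewrite linearP lf//; exact: sr_stable. Qed.

HB.instance Definition _ := gen_eqMixin dlinear.
HB.instance Definition _ := gen_choiceMixin dlinear.

Definition dl_zero := restrict linear_on0.
Definition dl_add (f g : dlinear) :=
  restrict (linear_onD (@dl_linear f) (@dl_linear g)).
Definition dl_opp (f : dlinear) := restrict (linear_onN (@dl_linear f)).
Definition dl_scale a (f : dlinear) :=
  restrict (linear_on_actl a (@dl_linear f)).
Definition dl_rscale (f : dlinear) a :=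
  restrict (linear_on_actr a (@dl_linear f)).

Let addA : associative dl_add.
Proof. by move=> f g h; apply: dlinear_ext => x Px; rewrite !restrictE// addrA. Qed.
Let addC : commutative dl_add.
Proof. by move=> f g; apply: dlinear_ext => x Px; rewrite !restrictE// addrC. Qed.
Let add0 : left_id dl_zero dl_add.
Proof. by move=> f; apply: dlinear_ext => x Px; rewrite !restrictE// add0r. Qed.
Let addN : left_inverse dl_zero dl_opp dl_add.
Proof. by move=> f; apply: dlinear_ext => x Px; rewrite !restrictE// addNr. Qed.

HB.instance Definition _ := GRing.isZmodule.Build dlinear addA addC add0 addN.

Let scaleA a b f : dl_scale a (dl_scale b f) = dl_scale (a * b) f.
Proof. by apply: dlinear_ext => x Px; rewrite !restrictE// sr_actM. Qed.
Let scale1 : left_id 1 dl_scale.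
Proof. by move=> f; apply: dlinear_ext => x Px; rewrite !restrictE// sr_act1. Qed.
Let scaleDr : right_distributive dl_scale +%R.
Proof.
by move=> a f g; apply: dlinear_ext => x Px; rewrite !restrictE// linearD.
Qed.
Let scaleDl f : {morph dl_scale^~ f : a b / a + b}.
Proof.
by move=> a b; apply: dlinear_ext => x Px; rewrite !restrictE// sr_actD.
Qed.

HB.instance Definition _ :=
  GRing.Zmodule_isLmodule.Build A dlinear scaleA scale1 scaleDr scaleDl.

Lemma dl_addE (f g : dlinear) x : sr_dom P x -> (f + g) x = f x + g x.
Proof. exact: restrictE. Qed.

Lemma dl_scaleE a (f : dlinear) x :
  sr_dom P x -> (a *: f) x = sr_act P a (f x).
Proof. exact: restrictE. Qed.

(** [sr_domP] alone allows an empty domain; the point [x] provides $0=-x+x$. *)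
Lemma sr_dom0 x : sr_dom P x -> sr_dom P 0.
Proof.
by move=> Px; have := @sr_domP _ _ _ _ P (-1) x x Px Px; rewrite scaleN1r addNr.
Qed.

Lemma linear_onZ f c x :
  linear_on f -> sr_dom P x -> f (c *: x) = c *: f x.
Proof.
move=> lf Px; have P0 := sr_dom0 Px.
have f0 : f 0 = 0 by have := lf (-1) _ _ Px Px; rewrite !scaleN1r !addNr.
by rewrite -[in LHS](addr0 (c *: x)) lf// f0 addr0.
Qed.

Lemma linear_on_add T x y : linear_on T -> sr_dom P x -> sr_dom P y ->
  T (x + y) = T x + T y.
Proof. by move=> lT Px Py; rewrite -[in LHS](scale1r x) lT// scale1r. Qed.

Lemma sr_act_scalar k x : sr_act P k%:A x = sr_scalar P k *: x.
Proof. by rewrite sr_actZ sr_act1. Qed.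

Let rscaleA f a b : dl_rscale (dl_rscale f a) b = dl_rscale f (a * b).
Proof.
by apply: dlinear_ext => x Px; rewrite !restrictE ?sr_actM//; exact: sr_stable.
Qed.
Let rscale1 f : dl_rscale f 1 = f.
Proof. by apply: dlinear_ext => x Px; rewrite !restrictE// sr_act1. Qed.
Let rscaleDl (f g : dlinear) a :
  dl_rscale (f + g) a = dl_rscale f a + dl_rscale g a.
Proof.
by apply: dlinear_ext => x Px; rewrite !restrictE//; exact: sr_stable.
Qed.
Let rscaleDr f a b : dl_rscale f (a + b) = dl_rscale f a + dl_rscale f b.
Proof.
apply: dlinear_ext => x Px; rewrite !restrictE// sr_actD.
by rewrite (linear_on_add (@dl_linear f))//; exact: sr_stable.
Qed.
Let scalerscale a (f : dlinear) b : dl_rscale (a *: f) b = a *: dl_rscale f b.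
Proof.
by apply: dlinear_ext => x Px; rewrite !restrictE//; exact: sr_stable.
Qed.
(** On both sides [k%:A] acts as the scalar [sr_scalar P k], which commutes with a linear map. *)
Let scale_central (k : K) (f : dlinear) : (k%:A : A) *: f = dl_rscale f k%:A.
Proof.
apply: dlinear_ext => x Px; rewrite !restrictE// !sr_act_scalar.
by rewrite (linear_onZ _ (@dl_linear f)).
Qed.

HB.instance Definition _ :=
  Lmodule_isBimodule.Build K A dlinear
    rscaleA rscale1 rscaleDl rscaleDr scalerscale scale_central.

Lemma dl_rscaleE (f : dlinear) a x :
  sr_dom P x -> rscale f a x = f (sr_act P a x).
Proof. exact: restrictE. Qed.

(** * Commutators as derivations, and the fluctuation of an operator *)

Lemma linear_on_commutator T b : linear_on T ->
  linear_on (fun x => T (sr_act P b x) - sr_act P b (T x)).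
Proof.
move=> lT; apply: linear_onD; first exact: linear_on_actr.
by apply: linear_onN; exact: linear_on_actl.
Qed.

Definition commutator_with T (lT : linear_on T) (b : A) : dlinear :=
  restrict (linear_on_commutator b lT).

(** The Leibniz rule is the telescoping identity $[T,ab]=[T,a]b+a[T,b]$. *)
Lemma commutator_derivation T (lT : linear_on T) :
  derivation (commutator_with lT).
Proof.
split=> [a b|k a|a b]; apply: dlinear_ext => x Px.
- rewrite !restrictE// !sr_actD (linear_on_add lT); try exact: sr_stable.
  by rewrite opprD addrACA.
- rewrite !restrictE// sr_act_scalar !sr_actZ (linear_onZ _ lT).
    by rewrite scalerBr.
  exact: sr_stable.
- have Pb := sr_stable b Px.
  by rewrite !restrictE// !sr_actM linearB/= addrA subrK.
Qed.

(** This is $F_\rho(T,s)$. Working with plain functions lets [T] be [act D], arbitrary outside its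
    domain, or itself a fluctuation. *)
Definition fluct (T : H -> H) (s : presentation A) (x : H) : H :=
  T x + \sum_(p <- s)
    sr_act P p.1 (T (sr_act P p.2 x) - sr_act P p.2 (T x)).

Lemma dl_sum (I : Type) (r : seq I) (E : I -> dlinear) x : sr_dom P x ->
  (\sum_(i <- r) E i) x = \sum_(i <- r) E i x.
Proof.
move=> Px; elim: r => [|i r IH]; first by rewrite !big_nil; exact: restrictE.
by rewrite !big_cons -IH; exact: restrictE.
Qed.

(** The correction to [T] is the image of the form under a derivation, so an equality of one-forms
    carries over to operators. *)
Lemma fluctE T (lT : linear_on T) s x : sr_dom P x ->
  fluct T s x = T x + form_eval (commutator_with lT) s x.
Proof.
move=> Px; rewrite /fluct /form_eval dl_sum//; congr (_ + _).
by apply: eq_bigr => p _; rewrite !restrictE.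
Qed.

Lemma fluct_linear T s : linear_on T -> linear_on (fluct T s).
Proof.
move=> lT c x y Px Py; rewrite !(fluctE lT)//; last exact: sr_domP.
by rewrite lT// dl_linear// scalerDr addrACA.
Qed.

(** As the action preserves the domain, [T] is only evaluated inside it. *)
Lemma eq_fluct T T' s x : (forall y, sr_dom P y -> T y = T' y) ->
  sr_dom P x -> fluct T s x = fluct T' s x.
Proof.
move=> TT Px; rewrite /fluct TT//; congr (_ + _).
by apply: eq_bigr => p _; rewrite TT//; exact: sr_stable.
Qed.

(* rho(u) T rho(v) = T + rho(u)[T, rho(v)], so conjugating T + eta(T) with eta
   the image of w in the bimodule adds the image of u delta(v) + u w v. *)
Lemma fluct_gauge T (s t : presentation A) u v x :
  linear_on T -> u * v = 1 -> sr_dom P x ->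
  u *: delta v + rscale (u *: form_eval (@delta K A) s) v
    = form_eval (@delta K A) t ->
  sr_act P u (fluct T s (sr_act P v x)) = fluct T t x.
Proof.
move=> lT uv Px st; have dd := commutator_derivation lT.
rewrite !(fluctE lT)//; last exact: sr_stable.
rewrite -(Omega1_eval_sum t dd) -st (Omega1_evalD dd) (Omega1_evalZ dd).
rewrite (Omega1_evalR dd) (Omega1_evalZ dd) (Omega1_eval_sum s dd).
rewrite Omega1_eval_delta// dl_addE// dl_scaleE// dl_rscaleE//.
rewrite dl_scaleE; last exact: sr_stable.
rewrite [X in _ = _ + (sr_act P u X + _)]restrictE// linearD/= linearB/=.
by rewrite -(sr_actM _ u v) uv sr_act1 addrA addrCA subrr addr0.
Qed.

End LinearOnDomain.

(** * Antilinear isometries, adjoints and sums of operators *)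

Section Hilbert.
Variables (R : realType) (H : hilbertType R).

Lemma inner_conj (x y : H) : inner x y = conjC (inner y x).
Proof. by rewrite hermC expr0 mul1r. Qed.

Lemma inner_addE (x y : H) : inner (x + y) (x + y) =
  inner x x + inner y y + (inner x y + conjC (inner x y)).
Proof. by rewrite -[conjC _]mul1r; exact: (hnormD (@inner R H)). Qed.

Lemma inner_inj (y z : H) : (forall x : H, inner x y = inner x z) -> y = z.
Proof.
move=> yz; have : `|y - z| ^+ 2 = 0 by rewrite -innerE linearBr/= yz subrr.
by move=> /eqP; rewrite expf_eq0/= normr_eq0 subr_eq0 => /eqP.
Qed.

Lemma antilinearD (J : antilinear_isometry H) x y : J (x + y) = J x + J y.
Proof.
by rewrite -[in LHS](scale1r x) aiso_antilinear rmorph1 scale1r.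
Qed.

Lemma antilinear0 (J : antilinear_isometry H) : J 0 = 0.
Proof. by apply: (addrI (J 0)); rewrite -antilinearD !addr0. Qed.

Lemma antilinearZ (J : antilinear_isometry H) c x :
  J (c *: x) = conjC c *: J x.
Proof. by rewrite -[in LHS](addr0 (c *: x)) aiso_antilinear antilinear0 addr0. Qed.

Lemma antilinear_inv (J : antilinear_isometry H) (c : R[i]) x y :
  aiso_inv J (c *: x + y) = conjC c *: aiso_inv J x + aiso_inv J y.
Proof.
apply: (can_inj (aisoK J)).
by rewrite aiso_antilinear conjCK !aiso_invK.
Qed.

(** Polarisation: expanding $\|J(x'+y)\|^2=\|x'+y\|^2$ compares real parts, and taking $x'=x$ and
    $x'=ix$ determines the whole inner product. *)
Lemma aiso_inner (J : antilinear_isometry H) x y :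
  inner (J x) (J y) = inner y x.
Proof.
have polar x' : inner (J x') (J y) + conjC (inner (J x') (J y))
    = inner x' y + conjC (inner x' y).
  have : inner (J (x' + y)) (J (x' + y)) = inner (x' + y) (x' + y).
    by rewrite !innerE aiso_norm.
  rewrite antilinearD !inner_addE !innerE !aiso_norm.
  exact: addrI.
have E1 := polar x; have := polar ('i *: x).
rewrite antilinearZ !linearZl_LR/= !rmorphM/= conjCK conjCi => E2.
apply/esym; rewrite inner_conj.
move: E1 E2; set g := inner (J x) (J y); set h := inner x y.
move: (conjC g) (conjC h) => g' h'.
move=> E1 E2; apply/eqP; rewrite -subr_eq0.
(* With conjugates as independent variables, [E1] and [E2] make both differences on the right
   vanish. *)
have : 2 * 'i * (h' - g) = 'i * ((h + h') - (g + g'))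
    - (('i * h + - 'i * h') - (- 'i * g + 'i * g')) by ring.
rewrite E1 E2 !subrr mulr0 subr0 => /eqP.
by rewrite !mulf_eq0 pnatr_eq0 (negPf (neq0Ci _)).
Qed.

(** The value chosen by [xget] in [adjoint] is unique by [inner_inj], hence equal to [g y]. *)
Lemma adjoint_total (T : partop H) (g : H -> H) :
  dom T = setT -> (forall x y : H, inner (act T x) y = inner x (g y)) ->
  adjoint T =op Defs.total g.
Proof.
move=> domT Tg; split=> [|y _] /=.
  by apply/seteqP; split=> y _ //=; exists (g y) => x _.
have gy : [set z | forall x, dom T x -> inner (act T x) y = inner x z]%classic (g y).
  by move=> x _.
have := @xgetPex _ 0 _ (ex_intro _ _ gy).
set z := xget _ _ => zP; apply: inner_inj => x.
by rewrite -zP ?domT// Tg.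
Qed.

Lemma act_opsum (I : Type) (r : seq I) (F : I -> partop H) x :
  act (\opsum_(i <- r) F i) x = \sum_(i <- r) act (F i) x.
Proof. by elim: r => [|i r IH]; rewrite ?big_nil// !big_cons -IH. Qed.

Lemma dom_opsum (I : Type) (r : seq I) (F : I -> partop H) x :
  (forall i, dom (F i) x) -> dom (\opsum_(i <- r) F i) x.
Proof. by move=> Fx; elim: r => [|i r IH]; rewrite ?big_nil// big_cons. Qed.

End Hilbert.

(** * The two commuting actions of a real spectral triple *)

Section Triple.
Variables (R : realType) (K : scalars R) (A : starAlgType K).
Variables (H : hilbertType R) (X : real_spectral_triple A H).

Let D := rst_D X.
Let J := rst_J X.

(** Convertible to the action of [opp_alg_op X a]. *)
Definition hat_rep (a : A) (x : H) : H := J (rst_rep X a (aiso_inv J x)).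

Lemma rep_linear a (c : R[i]) x y :
  rst_rep X a (c *: x + y) = c *: rst_rep X a x + rst_rep X a y.
Proof. by have [_ [_ rl] _] := rep_bounded (rst_rep X) a; case: (rl c x y). Qed.

Lemma hat_rep_linear a (c : R[i]) x y :
  hat_rep a (c *: x + y) = c *: hat_rep a x + hat_rep a y.
Proof.
by rewrite /hat_rep antilinear_inv rep_linear aiso_antilinear conjCK.
Qed.

(** The domain of $JDJ^{-1}$ is $J(\mathrm{Dom}\,D)$, and that of $\epsilon D$ is
    $\mathrm{Dom}\,D$. *)
Lemma dom_aiso_inv x : dom D (aiso_inv J x) <-> dom D x.
Proof.
have [eps _ [domE _] ] := rst_JD X; rewrite -/D -/J in domE.
split=> Dx; first by rewrite -[dom D]domE.
have : dom (eps *: D)%partop x by [].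
by rewrite -domE => -[_ [? _] ].
Qed.

Lemma hat_rep_stable a x : dom D x -> dom D (hat_rep a x).
Proof.
move=> Dx; apply/dom_aiso_inv; rewrite /hat_rep aisoK.
by apply: rst_preserves_dom; apply/dom_aiso_inv.
Qed.

Lemma rep_hat_comm a b x :
  rst_rep X a (hat_rep b x) = hat_rep b (rst_rep X a x).
Proof.
have [_ /(_ x)] := rst_commutant X a b => E.
by apply/eqP; rewrite -subr_eq0; apply/eqP; exact: E.
Qed.

(** [J] swaps the arguments of the inner product; doing so twice around [rep_star] restores their
    order. *)
Lemma hat_rep_star a x y :
  inner (hat_rep a x) y = inner x (hat_rep (star a) y).
Proof.
rewrite /hat_rep -[in LHS](aiso_invK J y) aiso_inner inner_conj rep_star.
by rewrite -inner_conj -(aiso_inner J) aiso_invK.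
Qed.

Lemma rst_dom_lin (c : R[i]) x y : dom D x -> dom D y -> dom D (c *: x + y).
Proof.
move=> Dx Dy; have [ [_ Dl] _ _] := rst_self_adjoint X.
by case: (Dl c x y Dx Dy).
Qed.

Definition left_rep : subspace_rep A H :=
  @SubspaceRep K R[i] A H (dom D) (rst_rep X) (scalar_embed K) rst_dom_lin
    (@rst_preserves_dom _ _ _ _ X) rep_linear (rep1 (rst_rep X))
    (repM (rst_rep X)) (repD (rst_rep X)) (repZ (rst_rep X)).

Lemma hat_rep1 x : hat_rep 1 x = x.
Proof. by rewrite /hat_rep rep1 aiso_invK. Qed.

Lemma hat_repM a b x : hat_rep (a * b) x = hat_rep a (hat_rep b x).
Proof. by rewrite /hat_rep repM aisoK. Qed.

Lemma hat_repD a b x : hat_rep (a + b) x = hat_rep a x + hat_rep b x.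
Proof. by rewrite /hat_rep repD antilinearD. Qed.

Lemma hat_repZ (k : K) a x :
  hat_rep (k *: a) x = conjC (scalar_embed K k) *: hat_rep a x.
Proof. by rewrite /hat_rep repZ antilinearZ. Qed.

Definition opposite_rep : subspace_rep A H :=
  @SubspaceRep K R[i] A H (dom D) hat_rep (conjC \o scalar_embed K)
    rst_dom_lin hat_rep_stable hat_rep_linear hat_rep1 hat_repM hat_repD
    hat_repZ.

Lemma rst_D_linear : linear_on left_rep (act D).
Proof.
move=> c x y Dx Dy; have [ [_ Dl] _ _] := rst_self_adjoint X.
by case: (Dl c x y Dx Dy).
Qed.

(** Additivity of the commutator merges $\hat a_j[D,\hat b_j]$ and $\sum_k\hat a_j[a_k[D,b_k],\hat
    b_j]$ into $\hat a_j[F_\pi(D,s),\hat b_j]$. *)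
Lemma act_fluctuated s x : dom D x -> act (fluctuated X s) x
  = fluct opposite_rep (fluct left_rep (act D) s) s x.
Proof.
move=> Dx; rewrite /fluctuated /= !act_opsum /fluct /= -!addrA.
congr (_ + (_ + _)); rewrite -big_split/=; apply: eq_bigr => p _.
pose P := opposite_rep.
rewrite act_opsum /= -[hat_rep p.1]/(sr_act P p.1) -[hat_rep p.2]/(sr_act P p.2).
rewrite (raddfD (sr_act P p.2)).
rewrite opprD addrACA (raddfD (sr_act P p.1)); congr (_ + _).
by rewrite (raddf_sum (sr_act P p.2)) -sumrB (raddf_sum (sr_act P p.1)).
Qed.

Lemma dom_fluctuated s : dom (fluctuated X s) = dom D.
Proof.
apply/seteqP; split=> x; first by move=> [ [ [? _] _] _].
move=> Dx; have rs a := @rst_preserves_dom _ _ _ _ X a.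
(* [hat_rep_stable] in the unfolded form met in the goals below. *)
have hs a y : dom D y -> dom D (J (rst_rep X a (aiso_inv J y))).
  exact: hat_rep_stable.
split; [split; [split=> //|]|]; apply: dom_opsum => p;
  last apply: dom_opsum => q.
all: by do ![split=> //=]; do ?[exact: rs|exact: hs|apply: rs].
Qed.

Lemma dom_gauge_op u : dom (gauge_op X u) = setT.
Proof. by apply/seteqP; split=> x _; do ?split. Qed.

Lemma adjoint_gauge_op u : adjoint (gauge_op X u)
  =op Defs.total (fun x => hat_rep (star u) (rst_rep X (star u) x)).
Proof.
apply: adjoint_total => [|x y]; first exact: dom_gauge_op.
by rewrite rep_star hat_rep_star.
Qed.

(* The left action commutes with its opposite, so conjugation by rho(u)
   passes through the second fluctuation. *)
Lemma fluct_hat_conj T s u v x :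
  rst_rep X u (fluct opposite_rep T s (rst_rep X v x))
  = fluct opposite_rep (fun y => rst_rep X u (T (rst_rep X v y))) s x.
Proof.
rewrite /fluct -[rst_rep X u]/(sr_act left_rep u).
rewrite (raddfD (sr_act left_rep u)) (raddf_sum (sr_act left_rep u)).
congr (_ + _); apply: eq_bigr => p _.
rewrite /= rep_hat_comm -[rst_rep X u]/(sr_act left_rep u).
by rewrite (raddfB (sr_act left_rep u))/= (rep_hat_comm u) (rep_hat_comm v).
Qed.

Lemma act_gauge_fluctuated s t u v x : u * v = 1 -> dom D x ->
  u *: delta v + rscale (u *: form_eval (@delta K A) s) v
    = form_eval (@delta K A) t ->
  rst_rep X u (hat_rep u (act (fluctuated X s) (hat_rep v (rst_rep X v x))))
  = act (fluctuated X t) x.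
Proof.
move=> uv Dx st.
have rs a y := @rst_preserves_dom _ _ _ _ X a y.
rewrite !act_fluctuated//; last by apply: hat_rep_stable; exact: rs.
rewrite -[hat_rep u]/(sr_act opposite_rep u).
rewrite -[hat_rep v]/(sr_act opposite_rep v).
rewrite (fluct_gauge _ uv _ st); last 2 first.
- exact: fluct_linear rst_D_linear.
- exact: rs.
(* The outer form is now [t]; conjugation by $u$ moves inside and transforms the inner one on
   [dom D]. *)
rewrite fluct_hat_conj; apply: eq_fluct => // y Dy.
exact: (fluct_gauge (P := left_rep) rst_D_linear uv Dy st).
Qed.

End Triple.

(* s and t are arbitrary presentations of A and of gamma_u(A). *)
Theorem lemma3 (R : realType) (K : scalars R) (A : starAlgType K)
    (H : hilbertType R) (X : real_spectral_triple A H)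
    (w : Omega1 A) (s t : presentation A) (u : A) :
  unitary u ->
  w = \sum_(p <- s) p.1 *: delta p.2 ->
  gauge_form u w = \sum_(p <- t) p.1 *: delta p.2 ->
  (gauge_op X u * fluctuated X s * adjoint (gauge_op X u))%partop
    =op fluctuated X t.
Proof.
move=> [uv _] -> st; have [domE actE] := adjoint_gauge_op X u.
have act_adj x : act (adjoint (gauge_op X u)) x
    = hat_rep X (star u) (rst_rep X (star u) x) by rewrite actE ?domE.
have domP x : dom (rst_D X) (hat_rep X (star u) (rst_rep X (star u) x))
    <-> dom (rst_D X) x.
  split=> Dx; last by apply: hat_rep_stable; exact: rst_preserves_dom.
  (* This is $x=UU^*x$, so $U^*x\in\mathrm{Dom}\,D$ gives $x\in\mathrm{Dom}\,D$. *)
  have -> : x = rst_rep X u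
      (hat_rep X u (hat_rep X (star u) (rst_rep X (star u) x))).
    by rewrite -hat_repM uv hat_rep1 -repM uv rep1.
  by apply: rst_preserves_dom; exact: hat_rep_stable.
(* Since $U$ and $U^*$ are everywhere defined, the only condition is $U^*x\in\mathrm{Dom}\,D$. *)
have domF x : dom (gauge_op X u * fluctuated X s
    * adjoint (gauge_op X u))%partop x <-> dom (rst_D X) x.
  have domFE : dom (fluctuated X s) (act (adjoint (gauge_op X u)) x)
      <-> dom (rst_D X) x by rewrite act_adj dom_fluctuated.
  split=> [ [_ [/domFE] ]//|/domFE Fx].
  by split; [rewrite domE|split; rewrite ?dom_gauge_op].
split=> [|x /domF Dx].
  by rewrite dom_fluctuated; apply/seteqP; split=> x /domF.
by rewrite -(act_gauge_fluctuated uv Dx st) -act_adj.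
Qed.
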